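(* Let $G$ be a connected bipartite graph with $s$ vertices and $m$ edges, let $K$ be a field of any characteristic, and let $A$ be the incidence matrix of $G$ over $K$. Let $\mathbb{X}$ be the set of points of $\mathbb{P}^{s-1}$ defined by the column vectors of $A$, and let $\lambda_r(G)$ be the $r$-th edge connectivity of $G$. Then $\dim_K(C_\mathbb{X}(1))=s-1$, $\dim_K(C_\mathbb{X}(d))=m$ for all $d\geq 2$, and $$ \delta_\mathbb{X}(d,r)=\begin{cases} \lambda_r(G)&\text{if }d=1\text{ and }1\leq r\leq s-1,\\ r&\text{if } d\geq 2\text{ and }1\leq r\leq m. \end{cases} $$
   Context: Graphs are finite and simple. Let $G$ be a graph with vertices $t_1,\ldots,t_s$ and edges $f_1,\ldots,f_m$. The incidence matrix of $G$ is the $s\times m$ matrix $A=(a_{ij})$ over $K$ with $a_{ij}=1$ if $t_i\in f_j$ and $a_{ij}=0$ otherwise. Let $P_1,\ldots,P_m\in K^s$ be its columns and $\mathbb{X}=\{[P_1],\ldots,[P_m]\}\subset\mathbb{P}^{s-1}$ the corresponding set of points in projective space over $K$. The $r$-th edge connectivity $\lambda_r(G)$ is the minimum number of edges of $G$ whose removal results in a graph with $r+1$ connected components. Let $S=K[t_1,\ldots,t_s]=\bigoplus_{d\geq 0}S_d$ with the standard grading (the vertices are identified with the variables). The vanishing ideal $I(\mathbb{X})$ is the graded ideal of $S$ generated by the homogeneous polynomials vanishing at all points of $\mathbb{X}$. For a finite set $F$ of homogeneous polynomials, $V_\mathbb{X}(F)$ is the set of common zeros of $F$ in $\mathbb{X}$.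 For integers $d,r\geq 1$, $$\delta_\mathbb{X}(d,r)=\min\{|\mathbb{X}\setminus V_\mathbb{X}(F)| : F=\{f_i\}_{i=1}^r\subset S_d,\ \dim_K(\{\overline{f}_i\}_{i=1}^r)=r\},$$ where $\overline{f}_i=f_i+I(\mathbb{X})$ and $\dim_K(\{\overline f_i\}_{i=1}^r)$ is the dimension of the $K$-span of these classes in $S/I(\mathbb{X})$. The projective Reed--Muller-type code $C_\mathbb{X}(d)$ is the image of the linear map ${\rm ev}_d\colon S_d\to K^m$, $f\mapsto(f(P_1),\ldots,f(P_m))$. *)

(* Defs.v *)
From HB Require Import structures.
From mathcomp Require Import all_boot all_order all_algebra.
From mathcomp Require Import finmap mpoly.

Set Implicit Arguments.
Unset Strict Implicit.
Unset Printing Implicit Defensive.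

Import GRing.Theory.
Local Open Scope ring_scope.

Definition is_min (P : nat -> Prop) (n : nat) : Prop :=
  P n /\ (forall k, P k -> (n <= k)%N).

(* Vertices are 'I_s and edges are labelled by 'I_m; injectivity of the
   labelling excludes multiple edges, #|edge j| = 2 excludes loops. *)
Record sgraph (s m : nat) := SGraph {
  edge : 'I_m -> {set 'I_s};
  card_edge : forall j, #|edge j| = 2%N;
  edge_inj : injective edge }.

Section Graph.
Context (s m : nat) (G : sgraph s m).

(* Adjacency in the graph obtained from G by removing the edges in B. *)
Definition adj_del (B : {set 'I_m}) : rel 'I_s :=
  fun x y => [exists j, (j \notin B) && (edge G j == [set x; y])].

Lemma adj_del_sym B : ssrbool.symmetric (adj_del B).
Proof. by move=> x y; apply: eq_existsb => j; rewrite setUC. Qed.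

Definition ncomp_del (B : {set 'I_m}) : nat :=
  n_comp (adj_del B) [set: 'I_s].

Definition connected_graph : Prop := ncomp_del set0 = 1%N.

Definition bipartite_graph : Prop :=
  exists U : {set 'I_s}, forall x y, adj_del set0 x y -> (x \in U) != (y \in U).

(* The r-th edge connectivity of G exists and equals n. *)
Definition edge_connectivity (r n : nat) : Prop :=
  is_min (fun k => exists2 B : {set 'I_m}, #|B| = k & ncomp_del B = r.+1) n.

End Graph.

Definition incidence_mx (K : fieldType) (s m : nat) (G : sgraph s m) :
  'M[K]_(s, m) := \matrix_(i, j) (i \in edge G j)%:R.

Section Points.
Context (K : fieldType) (s : nat).

Definition evalv (v : 'cV[K]_s) (f : {mpoly K[s]}) : K := f.@[fun i => v i 0].

(* Points of the projective space P^(s-1) are the lines of K^s. *)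
Definition proj_points (m : nat) (A : 'M[K]_(s, m)) : {fset {vspace 'cV[K]_s}} :=
  [fset <[col j A]>%VS | j : 'I_m]%fset.

(* vpick x is a nonzero vector of the line x; for homogeneous f the choice of
   this representative is irrelevant. *)
Definition vanishes (f : {mpoly K[s]}) (x : {vspace 'cV[K]_s}) : bool :=
  evalv (vpick x) f == 0.

Implicit Type X : {fset {vspace 'cV[K]_s}}.

Definition vanishing_ideal X (f : {mpoly K[s]}) : Prop :=
  exists (n : nat) (g h : 'I_n -> {mpoly K[s]}),
    [/\ forall i, g i \is homog mdeg,
        forall i x, x \in X -> vanishes (g i) x
      & f = \sum_i h i * g i].

Definition zeros X (r : nat) (F : 'I_r -> {mpoly K[s]}) :
  {fset {vspace 'cV[K]_s}} :=
  [fset x in X | [forall i, vanishes (F i) x]]%fset.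

End Points.

Section QuotientDimension.
Context (K : fieldType) (V : lmodType K) (N : V -> Prop).

(* For a subspace N, the class v + N lies in the span of the classes f i + N. *)
Definition in_span_mod (r : nat) (f : 'I_r -> V) (v : V) : Prop :=
  exists c : 'I_r -> K, N (v - \sum_i c i *: f i).

(* The span of the classes f i + N in V / N has a basis of n elements
   (the classes of the vectors b k). *)
Definition dim_span_mod (r : nat) (f : 'I_r -> V) (n : nat) : Prop :=
  exists b : 'I_n -> V,
    [/\ forall k, in_span_mod f (b k),
        forall i, in_span_mod b (f i)
      & forall c : 'I_n -> K, N (\sum_k c k *: b k) -> forall k, c k = 0].

End QuotientDimension.

(* delta_X(d, r) exists and equals n. *)
Definition gen_min_dist (K : fieldType) (s : nat)
    (X : {fset {vspace 'cV[K]_s}}) (d r n : nat) : Prop :=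
  is_min (fun k => exists F : 'I_r -> {mpoly K[s]},
    [/\ forall i, F i \is d.-homog,
        dim_span_mod (vanishing_ideal X) F r
      & #|` (X `\` zeros X F)%fset | = k]) n.

(* S_d. The library makes dhomog n K d a vectType only for n of the form n'.+1;
   this alias carries the same structure for every n. *)
Definition hform (s : nat) (K : fieldType) (d : nat) : Type := dhomog s K d.

HB.instance Definition _ (s : nat) (K : fieldType) (d : nat) :=
  GRing.Lmodule.on (hform s K d).

Definition hform_dim (s d : nat) : nat :=
  if s is n.+1 then 'C(d + n, d) else (d == 0%N).

Lemma hform_vecaxiom s (K : fieldType) d :
  Vector.axiom (hform_dim s d) (hform s K d).
Proof.
case: s => [|n]; last exact: dhomog_vecaxiom.
have mnm0 (m : 'X_{1..0}) : m = 0%MM by apply/mnmP; case.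
exists (fun p : hform 0 K d => \row_(i < hform_dim 0 d) (\val p)@_0%MM).
  by move=> a p q; apply/rowP => i; rewrite !mxE /= mcoeffD mcoeffZ.
case: d => [|d].
  have h (r : 'rV[K]_1) : (r 0 0)%:MP_[0] \is 0.-homog.
    by apply/dhomogP => m _; rewrite /= mdegE big_ord0.
  exists (fun r => DHomog (h r)) => [p|r].
    apply/val_inj/mpolyP => m /=; rewrite (mnm0 m) mcoeffC eqxx mulr1.
    by rewrite mxE.
  by apply/rowP => i; rewrite mxE /= mcoeffC eqxx mulr1 ord1.
exists (fun=> 0) => [p|r]; last by apply/rowP; case.
apply/val_inj/mpolyP => m /=; rewrite mcoeff0.
apply/esym/(dhomog_nemf_coeff (dhomog_is_dhomog p)).
by rewrite /= mdegE big_ord0.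
Qed.

HB.instance Definition _ (s : nat) (K : fieldType) (d : nat) :=
  Lmodule_hasFinDim.Build K (hform s K d) (@hform_vecaxiom s K d).

Section Code.
Context (K : fieldType) (s m : nat) (A : 'M[K]_(s, m)) (d : nat).

Definition ev (f : hform s K d) : 'rV[K]_m :=
  \row_j evalv (col j A) (\val f).

Lemma ev_is_linear : linear ev.
Proof.
move=> a f g; apply/rowP => j.
by rewrite !mxE /evalv -mevalZ -mevalD.
Qed.

HB.instance Definition _ :=
  GRing.isLinear.Build K (hform s K d) 'rV[K]_m _ ev ev_is_linear.

Definition rm_code : {vspace 'rV[K]_m} := limg (linfun ev).

End Code.

(* Main.v *)
Require Import Defs.
From mathcomp Require Import all_boot all_order all_algebra.
From mathcomp Require Import finmap mpoly.

(** Write [A] for the incidence matrix. Since the points [P_j] are distinct and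
    forms are homogeneous, everything is read off the evaluation matrix
    [eval_mx A F = (F_i(P_j))]: the classes of the [F_i] in S/I(X) span a space
    of dimension [r] exactly when its rows are free ([dim_span_points]), and
    the points outside V_X(F) are its nonzero columns ([card_nonzeros]).

    For [d >= 2], an edge {x, y} has the form x^(d-1) y, which takes the value
    1 at that edge and 0 at every other one. The code is therefore all of K^m,
    and [r] independent rows need at least [r] nonzero columns, a bound reached
    by unit vectors ([gen_min_dist_separating]).

    For [d = 1], the evaluation matrices are the products [C *m A]. Let [B] be
    a set of edges. A linear form [a] vanishes on the edges outside [B] iff
    [a_x + a_y = 0] for each surviving edge {x, y}. Negating the coefficients on
    one side of the bipartition turns this into [a_x = a_y], in any
    characteristic, so the space of such forms has dimension [ncomp_del G B],
    the number of components of G - B ([rank_ker_deletion]). The forms vanishing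
    on all of X are the case [B = set0] and have dimension 1 by connectedness,
    so the codewords supported in [B] have dimension [ncomp_del G B - 1]
    ([rank_subcode]). Hence [r] independent codewords are supported in [B] iff
    G - B has at least [r + 1] components. The edge connectivity asks for
    exactly [r + 1]; restoring one edge lowers the rank defect of the surviving
    columns, hence the number of components, by at most one, so that some subset
    of [B] leaves exactly [r + 1] components ([exact_sub_deletion]). *)

(** * Edge deletion and the kernel of the incidence matrix *)

Section Deletion.

Import GRing.Theory.
Local Open Scope ring_scope.
Set Implicit Arguments.
Unset Strict Implicit.

Context (K : fieldType) (s m : nat) (G : sgraph s m).
Implicit Types (B : {set 'I_m}) (r : nat).

Let A := incidence_mx K G.

(** Right multiplication by this matrix erases the columns of the deleted
    edges; keeping them as zero columns lets all [B] share one matrix type. *)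
Definition surviving_mx B : 'M[K]_m := diag_mx (\row_j (j \notin B)%:R).

Lemma mulmx_surviving r (M : 'M[K]_(r, m)) B i j :
  (M *m surviving_mx B) i j = if j \in B then 0 else M i j.
Proof.
by rewrite mul_mx_diag !mxE; case: (j \in B); rewrite /= (mulr0, mulr1).
Qed.

Lemma mulmx_surviving_eq0 r (M : 'M[K]_(r, m)) B :
  M *m surviving_mx B = 0 <-> (forall i j, j \notin B -> M i j = 0).
Proof.
split=> [M0 i j jB | M0].
  by move/matrixP/(_ i j): M0; rewrite mulmx_surviving (negPf jB) mxE.
apply/matrixP=> i j; rewrite mulmx_surviving mxE.
by case: ifPn => // /M0.
Qed.

Lemma surviving_mx0 : surviving_mx set0 = 1%:M.
Proof. by apply/matrixP => i j; rewrite !mxE inE. Qed.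

Lemma mul_incidence r (C : 'M[K]_(r, s)) i j x y :
  edge G j = [set x; y] -> x != y -> (C *m A) i j = C i x + C i y.
Proof.
move=> ej xy; rewrite !mxE (bigD1 x) //= (bigD1 y) 1?eq_sym //=.
rewrite !mxE ej !inE !eqxx orbT !mulr1 big1 ?addr0 // => k /andP[kx ky].
by rewrite mxE ej !inE (negPf kx) (negPf ky) mulr0.
Qed.

Lemma adj_delP B x y :
  reflect (exists2 j, j \notin B & edge G j = [set x; y]) (adj_del G B x y).
Proof.
apply: (iffP existsP) => [[j /andP[? /eqP ?]]|[j jB ej]]; exists j => //.
by rewrite jB ej eqxx.
Qed.

Lemma edge_ends j : exists x y, x != y /\ edge G j = [set x; y].
Proof. by apply/cards2P; rewrite card_edge. Qed.

Context (U : {set 'I_s}).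
Hypothesis Ubip : forall x y, adj_del G set0 x y -> (x \in U) != (y \in U).

(* The change of sign on one side of the bipartition that makes the condition
   a_x + a_y = 0 along an edge say that [sgn * a] agrees at its two ends. *)
Let sgn x : K := (-1) ^+ (x \in U).

Let sgnK x : sgn x * sgn x = 1.
Proof. by rewrite /sgn -expr2 sqrr_sign. Qed.

Let sgn_edge j x y : edge G j = [set x; y] -> sgn y = - sgn x.
Proof.
move=> ej; have /Ubip : adj_del G set0 x y by apply/adj_delP; exists j; rewrite ?inE.
by rewrite /sgn; case: (x \in U); case: (y \in U); rewrite //= ?opprK.
Qed.

Section Components.
Context (B : {set 'I_m}).
Let e := adj_del G B.
Let rt := fingraph.root e.
Let e_sym : connect_sym e := sym_connect_sym (@adj_del_sym s m G B).

Definition root_set : {set 'I_s} := [set x | roots e x].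

Lemma card_root_set : #|root_set| = ncomp_del G B.
Proof. by rewrite /ncomp_del /n_comp_mem; apply: eq_card => x; rewrite !inE andbT. Qed.

Lemma root_enum_val (k : 'I_#|root_set|) : rt (enum_val k) = enum_val k.
Proof. by have := enum_valP k; rewrite inE => /eqP. Qed.

(** The signed indicator functions of the components of G - B, which are named
    by their [fingraph] roots. *)
Definition component_mx : 'M[K]_(#|root_set|, s) :=
  \matrix_(k, x) (sgn x *+ (rt x == enum_val k)).

(** Signed restriction of a linear form to the roots: a right inverse of
    [component_mx], hence also the coordinates in the basis of its rows. *)
Definition at_roots_mx : 'M[K]_(s, #|root_set|) :=
  \matrix_(x, k) (sgn x *+ (x == enum_val k)).

Lemma mul_at_roots r (C : 'M[K]_(r, s)) i k :
  (C *m at_roots_mx) i k = C i (enum_val k) * sgn (enum_val k).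
Proof.
rewrite mxE (bigD1 (enum_val k)) //= mxE eqxx big1 ?addr0 // => x /negPf xk.
by rewrite mxE xk mulr0.
Qed.

Lemma row_free_component : row_free component_mx.
Proof.
apply/row_freeP; exists at_roots_mx; apply/matrixP=> k l.
rewrite mul_at_roots !mxE root_enum_val (inj_eq enum_val_inj) eq_sym.
by rewrite mulrnAl sgnK.
Qed.

Lemma component_mx_ker : component_mx *m (A *m surviving_mx B) = 0.
Proof.
rewrite mulmxA; apply/mulmx_surviving_eq0 => k j jB.
have [x [y [xy ej]]] := edge_ends j.
rewrite (mul_incidence _ _ ej xy) !mxE (sgn_edge ej).
have -> : rt y = rt x.
  apply/eqP; rewrite eq_sym root_connect //; apply/connect1/adj_delP.
  by exists j.
by rewrite -mulrnDl subrr mul0rn.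
Qed.

(** Induction along a path: both sides agree across one surviving edge because
    the coefficients at its ends are opposite and so are their signs. *)
Lemma sgn_ker_const r (C : 'M[K]_(r, s)) i x y :
  C *m (A *m surviving_mx B) = 0 -> connect e x y ->
  C i x * sgn x = C i y * sgn y.
Proof.
rewrite mulmxA => /mulmx_surviving_eq0 C0 /connectP[p].
elim: p x => [|z p IH] x /= => [_ -> // | /andP[/adj_delP[j jB ej] pP] yE].
have xz : x != z.
  by have := card_edge G j; rewrite ej cards2; case: (x == z).
rewrite -(IH z) // (sgn_edge ej) mulrN -mulNr; congr (_ * _).
by apply/eqP; rewrite -addr_eq0 -(mul_incidence C i ej xz) C0.
Qed.

(** A form in the kernel is determined by its signed values at the roots, which
    are its coordinates on the component indicators. *)
Lemma ker_sub_component r (C : 'M[K]_(r, s)) :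
  C *m (A *m surviving_mx B) = 0 -> (C <= component_mx)%MS.
Proof.
move=> C0; apply/submxP; exists (C *m at_roots_mx); apply/matrixP=> i x.
have rx : rt x \in root_set by rewrite inE roots_root.
rewrite mxE (bigD1 (enum_rank_in rx (rt x))) //= big1 => [|k kx].
  rewrite mul_at_roots mxE enum_rankK_in // eqxx addr0.
  rewrite -(sgn_ker_const i C0 (connect_root e x)) -mulrA sgnK mulr1 //.
rewrite [X in _ * X]mxE; case: eqP => [rk|]; last by rewrite mulr0.
by case/eqP: kx; apply: enum_val_inj; rewrite enum_rankK_in.
Qed.

(** The component indicators form a basis of the kernel. This is the only place
    where the combinatorics of components meets linear algebra: what follows
    about [ncomp_del] is read off ranks. *)
Lemma rank_ker_deletion :
  \rank (kermx (A *m surviving_mx B)) = ncomp_del G B.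
Proof.
rewrite -card_root_set -(eqP row_free_component); apply/eqP.
rewrite eqn_leq !mxrankS //; first by apply/sub_kermxP/component_mx_ker.
exact/ker_sub_component/mulmx_ker.
Qed.

End Components.

Lemma rank_deletion B :
  (\rank (A *m surviving_mx B) + ncomp_del G B)%N = s.
Proof. by rewrite -rank_ker_deletion mxrank_ker subnKC ?rank_leq_row. Qed.

(** Restoring [j] adds one column to the surviving ones, which raises the rank
    by at most one. *)
Lemma ncomp_restore_edge B j : j \in B ->
  (ncomp_del G B <= (ncomp_del G (B :\ j)).+1)%N.
Proof.
move=> jB.
suff : (\rank (A *m surviving_mx (B :\ j)) <= (\rank (A *m surviving_mx B)).+1)%N.
  by rewrite -(leq_add2r (ncomp_del G (B :\ j))) rank_deletion addSnnS
             -[X in (X <= _)%N](rank_deletion B) leq_add2l.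
have -> : surviving_mx (B :\ j) = surviving_mx B + delta_mx j j.
  apply/matrixP=> k l; rewrite !mxE !inE.
  have [->|] := eqVneq k l; last first.
    by case: (eqVneq k j) => [->|_ _]; rewrite /= ?addr0 // eq_sym => /negPf ->; rewrite addr0.
  by case: (eqVneq l j) => [->|]; rewrite /= ?jB ?addr0 // mulr0n mulr1n add0r.
rewrite mulmxDr (leq_trans (mxrank_add _ _)) // -addn1 leq_add2l.
by rewrite (leq_trans (mxrankM_maxr _ _)) // mxrank_delta.
Qed.

Lemma ncomp_setT : ncomp_del G setT = s.
Proof.
rewrite -[RHS](rank_deletion setT).
have -> : A *m surviving_mx setT = 0.
  by apply/mulmx_surviving_eq0 => i j; rewrite inE.
by rewrite mxrank0.
Qed.

Hypothesis Gconn : connected_graph G.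

(** A discrete intermediate value argument: restoring the edges of [B] one at a
    time decreases the number of components to 1 in steps of at most one. *)
Lemma exact_sub_deletion B r : (r < ncomp_del G B)%N ->
  exists2 B' : {set 'I_m}, B' \subset B & ncomp_del G B' = r.+1.
Proof.
elim: #|B| {-2}B (erefl #|B|) => [|n IH] {}B cB.
  by rewrite (cards0_eq cB) Gconn ltnS leqn0 => /eqP ->; exists set0.
rewrite leq_eqVlt => /orP[/eqP rB|rB]; first by exists B; rewrite ?rB.
have /card_gt0P[j jB] : (0 < #|B|)%N by rewrite cB.
have [||B' sB' nB'] := IH (B :\ j).
- by apply/eqP; rewrite -eqSS -cB (cardsD1 j B) jB.
- by rewrite -ltnS (leq_trans rB) // ncomp_restore_edge.
by exists B' => //; apply: subset_trans sB' (subsetDl _ _).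
Qed.

Lemma edge_connectivity_exists r : (r < s)%N ->
  exists n, edge_connectivity G r n.
Proof.
move=> rs; have [|B0 _ nB0] := @exact_sub_deletion setT r; first by rewrite ncomp_setT.
pose P := [pred B | ncomp_del G B == r.+1].
case: (@arg_minnP _ B0 P (fun B => #|B|)) => [|B /eqP nB minB]; first exact/eqP.
by exists #|B|; split=> [|k [B' <- nB']]; [exists B | apply/minB/eqP].
Qed.

(** By [exact_sub_deletion], exactly [r + 1] components may be weakened to at
    least [r + 1] in the definition of the edge connectivity. *)
Lemma edge_connectivity_le r n B : edge_connectivity G r n ->
  (r < ncomp_del G B)%N -> (n <= #|B|)%N.
Proof.
move=> [_ minn] /exact_sub_deletion[B' sB' nB'].
by apply: leq_trans (minn _ _) (subset_leq_card sB'); exists B'.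
Qed.

Lemma rank_incidence : \rank A = (s - 1)%N.
Proof.
by rewrite -[in RHS](rank_deletion set0) surviving_mx0 mulmx1 Gconn addnK.
Qed.

Lemma rank_ker_incidence : \rank (kermx A) = 1.
Proof.
by rewrite -[A]mulmx1 -surviving_mx0 rank_ker_deletion.
Qed.

(** The rows of this product span the codewords supported in [B]. Passing from
    forms to codewords kills the forms that vanish at every edge; these form a
    line, which lies inside the kernel for [B]. *)
Lemma rank_subcode B :
  (\rank (kermx (A *m surviving_mx B) *m A)).+1 = ncomp_del G B.
Proof.
rewrite -rank_ker_deletion -(mxrank_mul_ker _ A) -addn1; congr (_ + _)%N.
rewrite -[LHS]rank_ker_incidence; apply: eqmx_rank; apply/andP; split; last exact: capmxSr.
rewrite sub_capmx submx_refl andbT.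
by apply/sub_kermxP; rewrite mulmxA mulmx_ker mul0mx.
Qed.

End Deletion.

(** * Dimension of spans in a quotient *)

Section QuotientSpan.

Import GRing.Theory.
Local Open Scope ring_scope.
Set Implicit Arguments.
Unset Strict Implicit.

Context (K : fieldType) (V : lmodType K) (N : V -> Prop).
Hypothesis N0 : N 0.
Hypothesis Nlin : forall a u v, N u -> N v -> N (a *: u + v).

Lemma subspaceD u v : N u -> N v -> N (u + v).
Proof. by move=> Nu Nv; rewrite -[u]scale1r; apply: Nlin. Qed.

Lemma subspaceB u v : N u -> N v -> N (u - v).
Proof. by move=> Nu Nv; rewrite addrC -scaleN1r; apply: Nlin. Qed.

Lemma subspace_sum (I : finType) (c : I -> K) (u : I -> V) :
  (forall i, N (u i)) -> N (\sum_i c i *: u i).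
Proof.
move=> Nu; elim/big_rec: _ => // i v _ Nv; exact: Nlin.
Qed.

Lemma comb_substE p q (x : 'I_p -> K) (D : 'I_p -> 'I_q -> K)
    (u : 'I_p -> V) (v : 'I_q -> V) :
  \sum_i x i *: (u i - \sum_l D i l *: v l) =
  \sum_i x i *: u i - \sum_l (\sum_i x i * D i l) *: v l.
Proof.
under eq_bigr do rewrite scalerBr.
rewrite sumrB; congr (_ - _).
under [RHS]eq_bigr do rewrite scaler_suml.
rewrite exchange_big; apply: eq_bigr => i _; rewrite scaler_sumr.
by apply: eq_bigr => l _; rewrite scalerA.
Qed.

(** If [b] is a basis of the span modulo [N], write [b = C f] and [f = D b]
    modulo [N]. Independence of [b] gives [C D = 1], hence [D C = 1] as the
    matrices are square, and a relation [c] among the [f i] satisfies [c D = 0],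
    so that [c = c D C = 0]. *)
Lemma dim_span_mod_free r (f : 'I_r -> V) :
  dim_span_mod N f r <->
  (forall c : 'I_r -> K, N (\sum_i c i *: f i) -> forall i, c i = 0).
Proof.
split=> [[b [/fin_all_exists[C NC] /fin_all_exists[D ND] bfree]] c Nc | ffree].
  have subD (x : 'I_r -> K) : N (\sum_i x i *: f i) ->
      forall l, \sum_i x i * D i l = 0.
    move=> Nx; apply: bfree.
    rewrite -[X in N X](subKr (\sum_i x i *: f i)) -comb_substE.
    by apply: subspaceB => //; apply: subspace_sum.
  pose Cm := \matrix_(k, i) C k i; pose Dm := \matrix_(i, k) D i k.
  have CD : Cm *m Dm = 1%:M.
    apply/matrixP=> k l; rewrite !mxE.
    pose y l := \sum_i C k i * D i l - (k == l)%:R.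
    suff /(_ l) /eqP : forall l, y l = 0.
      by rewrite subr_eq0 => /eqP <-; apply: eq_bigr => i _; rewrite !mxE.
    apply: bfree; rewrite /y; under eq_bigr do rewrite scalerBl.
    (* C D b - b = - (b - C f) - C (f - D b), a combination of relations. *)
    rewrite sumrB [X in _ - X](bigD1 k) //= eqxx scale1r.
    rewrite [X in _ - (_ + X)]big1 ?addr0; last first.
      by move=> j /negPf jk; rewrite eq_sym jk scale0r.
    rewrite -[X in N (X - _)](subKr (\sum_i C k i *: f i)) -comb_substE.
    rewrite addrAC -[X in N (X - _)]opprB -opprD -sub0r.
    apply: subspaceB => //; apply: subspaceD => //; exact: subspace_sum.
  have DC := mulmx1C CD.
  have cD : (\row_i c i) *m Dm = 0.
    apply/rowP=> l; rewrite !mxE -[RHS](subD c Nc l).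
    by apply: eq_bigr => i _; rewrite !mxE.
  have c0 : \row_i c i = 0 by rewrite -[LHS]mulmx1 -DC mulmxA cD mul0mx.
  by move=> i; move/rowP/(_ i): c0; rewrite !mxE.
exists f; split=> // i; exists (fun k => (i == k)%:R);
  rewrite (bigD1 i) //= eqxx scale1r big1 ?addr0 ?subrr // => j /negPf ji;
  by rewrite eq_sym ji scale0r.
Qed.

End QuotientSpan.

(** * Row spaces and supports *)

Section RowSpace.

Import GRing.Theory.
Local Open Scope ring_scope.
Set Implicit Arguments.
Unset Strict Implicit.

Lemma dim_vspace_rowspace (K : fieldType) (p m : nat) (M : 'M[K]_(p, m))
    (W : {vspace 'rV[K]_m}) :
  (forall w, w \in W <-> (w <= M)%MS) -> \dim W = \rank M.
Proof.
move=> WM; pose f : 'Hom('rV[K]_(\rank M), 'rV[K]_m) := linfun (mulmxr (row_base M)).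
have fE x : f x = x *m row_base M by rewrite lfunE.
have -> : W = limg f.
  apply/vspaceP=> w; apply/idP/memv_imgP => [/WM|[x _ ->]].
    rewrite -(eq_row_base M) => /submxP[x ->]; exists x; rewrite ?memvf ?fE //.
  by apply/WM; rewrite fE -(eq_row_base M) submxMl.
have fker : lker f = 0%VS.
  by apply/eqP/lker0P=> x y; rewrite !fE; apply/row_free_inj/row_base_free.
by rewrite limg_dim_eq ?fker ?capv0 // dimvf dim_matrix; exact: mul1n.
Qed.

Definition mx_support (K : fieldType) (r m : nat) (M : 'M[K]_(r, m)) : {set 'I_m} :=
  [set j | [exists i, M i j != 0]].

Lemma mx_supportPn (K : fieldType) (r m : nat) (M : 'M[K]_(r, m)) j :
  reflect (forall i, M i j = 0) (j \notin mx_support M).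
Proof.
rewrite inE negb_exists; apply: (iffP forallP) => M0 i; last by rewrite M0 eqxx.
by apply/eqP; have := M0 i; rewrite negbK.
Qed.

(** Erasing zero columns keeps the rows free, so that there are at most as many
    rows as remaining columns. *)
Lemma row_free_support (K : fieldType) (r m : nat) (M : 'M[K]_(r, m)) :
  row_free M -> (r <= #|mx_support M|)%N.
Proof.
move=> Mfree; pose h : 'I_#|mx_support M| -> 'I_m := enum_val.
suff /eqP rM : row_free (colsub h M) by rewrite -[X in (X <= _)%N]rM rank_leq_col.
apply: inj_row_free => v; rewrite mulmx_colsub => v0.
apply: (row_free_inj Mfree); rewrite mul0mx; apply/rowP=> j; rewrite [RHS]mxE.
have [jS|/mx_supportPn M0] := boolP (j \in mx_support M); last first.
  by rewrite mxE big1 // => i _; rewrite M0 mulr0.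
move/rowP/(_ (enum_rank_in jS j)): v0.
by rewrite [LHS]mxE [RHS]mxE /h enum_rankK_in.
Qed.

End RowSpace.

(** * Homogeneous forms and vanishing ideals *)

Section Forms.

Import GRing.Theory.
Local Open Scope ring_scope.
Set Implicit Arguments.
Unset Strict Implicit.

Context (K : fieldType) (s : nat).
Implicit Types (f : {mpoly K[s]}) (v : 'cV[K]_s) (X : {fset {vspace 'cV[K]_s}}).

Lemma evalv_sum v r (c : 'I_r -> K) (F : 'I_r -> {mpoly K[s]}) :
  evalv v (\sum_i c i *: F i) = \sum_i c i * evalv v (F i).
Proof.
by rewrite /evalv raddf_sum; apply: eq_bigr => i _; rewrite /= mevalZ.
Qed.

Lemma dhomog_comb d r (c : 'I_r -> K) (F : 'I_r -> {mpoly K[s]}) :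
  (forall i, F i \is d.-homog) -> \sum_i c i *: F i \is d.-homog.
Proof. by move=> Fd; apply: rpred_sum => i _; apply: dhomogZ. Qed.

Lemma vanishing_ideal0 X : vanishing_ideal X 0.
Proof.
exists 0%N, (fun=> 0), (fun=> 0); split=> [[]//|[]//|].
by rewrite big_ord0.
Qed.

Lemma vanishing_ideal_lin X a f g :
  vanishing_ideal X f -> vanishing_ideal X g -> vanishing_ideal X (a *: f + g).
Proof.
move=> [n1 [g1 [h1 [hom1 van1 ->]]]] [n2 [g2 [h2 [hom2 van2 ->]]]].
pose glue (u1 : 'I_n1 -> {mpoly K[s]}) (u2 : 'I_n2 -> {mpoly K[s]}) k :=
  match split k with inl i => u1 i | inr i => u2 i end.
exists (n1 + n2)%N, (glue g1 g2), (glue (fun i => a *: h1 i) h2); split.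
- by move=> k; rewrite /glue; case: (split k).
- by move=> k x xX; rewrite /glue; case: (split k) => i; [apply: van1 | apply: van2].
rewrite big_split_ord scaler_sumr /=; congr (_ + _); apply: eq_bigr => i _.
  by rewrite /glue -[lshift _ _]/(unsplit (inl i)) unsplitK scalerAl.
by rewrite /glue -[rshift _ _]/(unsplit (inr i)) unsplitK.
Qed.

(** The ideal is generated by forms vanishing on X, and vanishing at chosen
    representatives is inherited by combinations; a form vanishing on X is itself
    one of the generators. *)
Lemma vanishing_ideal_homog X d f : f \is d.-homog ->
  vanishing_ideal X f <-> (forall x, x \in X -> vanishes f x).
Proof.
move=> fd; split=> [[n [g [h [_ van ->]]]] x xX | van].
  rewrite /vanishes /evalv raddf_sum big1 // => i _ /=.
  by rewrite mevalM [X in _ * X](eqP (van i x xX)) mulr0.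
exists 1%N, (fun=> f), (fun=> 1); split=> [i|i x /van //|].
  by apply/homogP; exists d.
by rewrite big_ord1 mul1r.
Qed.

Lemma evalvZ d f a v : f \is d.-homog -> evalv (a *: v) f = a ^+ d * evalv v f.
Proof.
move=> /dhomogP fd; rewrite /evalv !mevalE mulr_sumr big_seq [RHS]big_seq.
apply: eq_bigr => k /fd <-; rewrite mulrCA; congr (_ * _).
under eq_bigr do rewrite mxE exprMn.
by rewrite big_split /= -expr_sum -mdegE.
Qed.

Lemma vanishes_line d f v : f \is d.-homog -> v != 0 ->
  vanishes f <[v]>%VS = (evalv v f == 0).
Proof.
move=> fd v0; rewrite /vanishes.
have /vlineP[a ea] := memv_pick <[v]>%VS.
have a0 : a != 0.
  apply: contra_neq v0 => a0; apply/eqP; move: ea; rewrite a0 scale0r.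
  by move/eqP; rewrite vpick0 => /eqP line0; rewrite -memv0 -line0 memv_line.
by rewrite ea (evalvZ _ _ fd) mulf_eq0 expf_eq0 (negPf a0) andbF.
Qed.

Lemma linear_form_coefE f : f \is 1.-homog -> f = \sum_i f@_U_(i) *: 'X_i.
Proof.
move=> f1; apply/mpolyP=> k; rewrite raddf_sum /=.
under eq_bigr do rewrite mcoeffZ mcoeffX.
have [/mdeg1P[i /eqP ->]|k1] := boolP (mdeg k == 1%N).
  rewrite (bigD1 i) //= eqxx mulr1 big1 ?addr0 // => j ji.
  by rewrite eq_mnm1 (negPf ji) mulr0.
rewrite (dhomog_nemf_coeff f1 k1) big1 // => i _.
by case: eqP => [ki|]; rewrite ?mulr0 //; rewrite -ki mdeg1 in k1.
Qed.

End Forms.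

(** * Evaluation at the columns of a matrix *)

Section Evaluation.

Import GRing.Theory.
Local Open Scope ring_scope.
Set Implicit Arguments.
Unset Strict Implicit.

Context (K : fieldType) (s m : nat) (A : 'M[K]_(s, m)).

Definition eval_mx r (F : 'I_r -> {mpoly K[s]}) : 'M[K]_(r, m) :=
  \matrix_(i, j) evalv (col j A) (F i).

Lemma eval_linear_forms r (F : 'I_r -> {mpoly K[s]}) :
  (forall i, F i \is 1.-homog) ->
  eval_mx F = (\matrix_(i, x) (F i)@_U_(x)) *m A.
Proof.
move=> F1; apply/matrixP=> i j; rewrite !mxE.
rewrite [in LHS](linear_form_coefE (F1 i)) evalv_sum.
by apply: eq_bigr => x _; rewrite /evalv mevalXU !mxE.
Qed.

Lemma linear_forms_of_mx r (C : 'M[K]_(r, s)) :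
  exists2 F : 'I_r -> {mpoly K[s]},
    forall i, F i \is 1.-homog & eval_mx F = C *m A.
Proof.
exists (fun i => \sum_x C i x *: 'X_x) => [i|].
  by apply: dhomog_comb => x; rewrite dhomogX /= mdeg1.
apply/matrixP=> i j; rewrite !mxE evalv_sum.
by apply: eq_bigr => x _; rewrite /evalv mevalXU !mxE.
Qed.

Lemma mem_rm_code d w : w \in rm_code A d <->
  exists2 f : {mpoly K[s]}, f \is d.-homog & w = eval_mx (fun _ : 'I_1 => f).
Proof.
split=> [/memv_imgP[f _ ->]|[f fd ->]].
  exists (\val f); first exact: dhomog_is_dhomog.
  by rewrite lfunE; apply/rowP=> j; rewrite !mxE.
apply/memv_imgP; exists (DHomog fd : hform s K d); rewrite ?memvf // lfunE.
by apply/rowP=> j; rewrite !mxE.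
Qed.

Lemma dim_code1 : \dim (rm_code A 1) = \rank A.
Proof.
apply: dim_vspace_rowspace => w; rewrite mem_rm_code.
split=> [[f f1 ->]|/submxP[c ->]].
  by rewrite eval_linear_forms // submxMl.
have [F F1 <-] := linear_forms_of_mx c; exists (F 0) => //.
by apply/matrixP=> i j; rewrite !mxE ord1.
Qed.

Hypothesis col_neq0 : forall j, col j A != 0.
Hypothesis line_inj : injective (fun j => <[col j A]>%VS).

Let X := proj_points A.

Lemma vanishing_ideal_points d f : f \is d.-homog ->
  vanishing_ideal X f <-> (forall j, evalv (col j A) f = 0).
Proof.
move=> fd; rewrite (vanishing_ideal_homog _ fd); split=> van.
  by move=> j; apply/eqP; rewrite -(vanishes_line fd) // van //; apply: in_imfset.
by move=> x /imfsetP[j _ ->]; rewrite (vanishes_line fd) // van.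
Qed.

Lemma dim_span_points d r (F : 'I_r -> {mpoly K[s]}) :
  (forall i, F i \is d.-homog) ->
  dim_span_mod (vanishing_ideal X) F r <-> row_free (eval_mx F).
Proof.
move=> Fd; rewrite dim_span_mod_free; last 2 first.
- exact: vanishing_ideal0.
- exact: vanishing_ideal_lin.
have evE (c : 'rV[K]_r) j :
    evalv (col j A) (\sum_i c 0 i *: F i) = (c *m eval_mx F) 0 j.
  by rewrite evalv_sum mxE; apply: eq_bigr => i _; rewrite mxE.
split=> [Ffree|Mfree c /(vanishing_ideal_points (dhomog_comb _ Fd)) c0 i].
  apply: inj_row_free => c cM; apply/rowP=> i; rewrite mxE; apply: (Ffree (c 0)).
  apply/(vanishing_ideal_points (dhomog_comb _ Fd)) => j.
  by rewrite evE cM mxE.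
have /rowP/(_ i) : \row_i c i = 0; last by rewrite !mxE.
apply: (row_free_inj Mfree); rewrite mul0mx; apply/rowP=> j.
rewrite -evE mxE -[RHS](c0 j); congr (evalv _ _).
by apply: eq_bigr => k _; rewrite mxE.
Qed.

Lemma card_nonzeros d r (F : 'I_r -> {mpoly K[s]}) :
  (forall i, F i \is d.-homog) ->
  #|` (X `\` zeros X F)%fset | = #|mx_support (eval_mx F)|.
Proof.
move=> Fd.
have -> : (X `\` zeros X F =
    [fset <[col j A]>%VS | j in mx_support (eval_mx F)])%fset.
  apply/fsetP=> x; rewrite in_fsetD.
  have zE j : (<[col j A]>%VS \notin zeros X F) = (j \in mx_support (eval_mx F)).
    have jX : <[col j A]>%VS \in X by apply: in_imfset.
    rewrite !inE /= -[Z in ~~ (Z && _)]/(<[col j A]>%VS \in X) jX negb_forall.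
    apply: eq_existsb => i.
    by rewrite (vanishes_line (Fd i)) // mxE.
  apply/andP/imfsetP => [[xz /imfsetP[j _ xj]]|[j jS ->]].
    by exists j => //; rewrite -zE -xj.
  by rewrite zE; split=> //; apply: in_imfset.
by rewrite card_imfset //= -cardE.
Qed.

(** All the projective geometry of the definition disappears once the columns of
    [A] are nonzero and represent distinct points. *)
Lemma gen_min_dist_eval d r n :
  gen_min_dist X d r n <->
  is_min (fun k => exists F : 'I_r -> {mpoly K[s]},
    [/\ forall i, F i \is d.-homog, row_free (eval_mx F)
      & #|mx_support (eval_mx F)| = k]) n.
Proof.
rewrite /gen_min_dist /is_min.
have codeE k :
  (exists F : 'I_r -> {mpoly K[s]}, [/\ forall i, F i \is d.-homog,
     dim_span_mod (vanishing_ideal X) F r & #|` (X `\` zeros X F)%fset | = k])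
  <-> (exists F : 'I_r -> {mpoly K[s]}, [/\ forall i, F i \is d.-homog,
     row_free (eval_mx F) & #|mx_support (eval_mx F)| = k]).
  split=> -[F [Fd Ffree <-]]; exists F; rewrite (card_nonzeros Fd);
    by split=> //; apply/(dim_span_points Fd).
by split=> -[/codeE ? minn]; split=> // k /codeE; apply: minn.
Qed.

(** Surjectivity of the evaluation map in degree [d], in the form in which it
    is checked: every unit vector is a codeword. *)
Definition separating d := forall j : 'I_m,
  exists2 f : {mpoly K[s]}, f \is d.-homog &
    forall l, evalv (col l A) f = (l == j)%:R.

Lemma separating_forms d r (M : 'M[K]_(r, m)) : separating d ->
  exists2 F : 'I_r -> {mpoly K[s]}, forall i, F i \is d.-homog & eval_mx F = M.
Proof.
move=> /fin_all_exists2[g gd gE].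
exists (fun i => \sum_j M i j *: g j) => [i|]; first exact: dhomog_comb.
apply/matrixP=> i l; rewrite mxE evalv_sum (bigD1 l) //= gE eqxx mulr1.
by rewrite big1 ?addr0 // => j /negPf jl; rewrite gE eq_sym jl mulr0.
Qed.

Lemma dim_code_separating d : separating d -> \dim (rm_code A d) = m.
Proof.
move=> sep; rewrite -[RHS](mxrank1 K); apply: dim_vspace_rowspace => w.
rewrite submx1 mem_rm_code; split=> // _.
have [F Fd FE] := separating_forms w sep; exists (F 0) => //.
by rewrite -FE; apply/matrixP=> i j; rewrite !mxE ord1.
Qed.

Lemma gen_min_dist_separating d r : separating d -> (r <= m)%N ->
  gen_min_dist X d r r.
Proof.
move=> sep rm; apply/gen_min_dist_eval; split=> [|k [F [_ /row_free_support ? <-]]] //.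
(* The first [r] unit vectors attain the bound. *)
have [F Fd FE] := separating_forms (pid_mx r : 'M[K]_(r, m)) sep.
have Ffree : row_free (eval_mx F) by rewrite FE /row_free rank_pid_mx.
exists F; split=> //; apply/eqP; rewrite eqn_leq row_free_support // andbT.
rewrite -[X in (_ <= X)%N](size_iota 0) cardE -(size_map val).
apply: uniq_leq_size; first by rewrite map_inj_uniq ?enum_uniq //; apply: val_inj.
move=> _ /mapP[j + ->]; rewrite mem_enum inE mem_iota FE => /existsP[i].
rewrite mxE add0n; case: (val i =P val j) => [<- _|]; rewrite ?eqxx //.
by rewrite ltn_ord.
Qed.

End Evaluation.

(** * Codes of bipartite graphs *)

Section Incidence.

Import GRing.Theory.
Local Open Scope ring_scope.
Set Implicit Arguments.
Unset Strict Implicit.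

Context (K : fieldType) (s m : nat) (G : sgraph s m).

Let A := incidence_mx K G.

Lemma incidence_colE j x : col j A x 0 = (x \in edge G j)%:R.
Proof. by rewrite !mxE. Qed.

Lemma incidence_col_neq0 j : col j A != 0.
Proof.
have [x [y [_ ej]]] := edge_ends G j; apply/eqP=> /colP/(_ x)/eqP.
by rewrite incidence_colE mxE ej !inE eqxx oner_eq0.
Qed.

(** Proportional 0-1 columns have the same support, and edges are determined by
    their ends. *)
Lemma incidence_line_inj : injective (fun j => <[col j A]>%VS).
Proof.
move=> j k jk; apply: (@edge_inj _ _ G); apply/setP=> x.
have /vlineP[a ea] : col j A \in <[col k A]>%VS by rewrite -jk memv_line.
have a0 : a != 0.
  by apply: contraNneq (incidence_col_neq0 j) => a0; rewrite ea a0 scale0r.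
move/colP/(_ x): ea; rewrite incidence_colE [RHS]mxE incidence_colE.
by case: (x \in edge G j); case: (x \in edge G k) => //= /eqP;
   rewrite ?mulr0 ?mulr1 ?oner_eq0 // eq_sym (negPf a0).
Qed.

(** The form x^(d-1) y takes the value 1 at the edges containing both x and y.
    Only one does, for lack of multiple edges; [d >= 2] makes both ends count. *)
Lemma incidence_separating d : (2 <= d)%N -> separating A d.
Proof.
case: d => [|[|d]] // _ j; have [x [y [xy ej]]] := edge_ends G j.
exists ('X_x ^+ d.+1 * 'X_y) => [|l].
  by rewrite mpolyXn -mpolyXD dhomogX /= mdegD mdegMn !mdeg1 mul1n addn1.
rewrite /evalv mevalM rmorphXn /= !mevalXU !incidence_colE -natrX -natrM.
congr (_%:R).
have -> : (l == j) = (x \in edge G l) && (y \in edge G l).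
  rewrite -(inj_eq (@edge_inj _ _ G)) eq_sym eqEcard !card_edge leqnn andbT ej.
  by rewrite subUset !sub1set.
by case: (x \in _); case: (y \in _); rewrite ?exp1n // exp0n.
Qed.

(** Independent codewords with joint support [B] force more than [r] components
    in G - B, which bounds [#|B|] below. Conversely, for an optimal [B], a basis
    of the codewords supported in [B] has [r] elements; its support cannot be
    smaller than [B] by the first bound. *)
Lemma gen_min_dist_edge_connectivity r n :
  connected_graph G -> bipartite_graph G -> edge_connectivity G r n ->
  gen_min_dist (proj_points A) 1 r n.
Proof.
move=> Gconn [U Ubip] rn.
have lower k : (exists F : 'I_r -> {mpoly K[s]},
    [/\ forall i, F i \is 1.-homog, row_free (eval_mx A F)
      & #|mx_support (eval_mx A F)| = k]) -> (n <= k)%N.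
  move=> [F [F1 Ffree <-]]; apply: (edge_connectivity_le K Ubip Gconn rn).
  rewrite -(rank_subcode K Ubip Gconn) ltnS -[X in (X <= _)%N](eqP Ffree).
  apply: mxrankS; rewrite [X in (X <= _)%MS]eval_linear_forms //.
  apply: submxMr; apply/sub_kermxP; rewrite mulmxA -eval_linear_forms //.
  by apply/mulmx_surviving_eq0 => i j /mx_supportPn.
apply/(gen_min_dist_eval (incidence_col_neq0) incidence_line_inj); split=> //.
have [[B cB nB] _] := rn.
have := rank_subcode K Ubip Gconn B; rewrite nB => -[rB].
have /submxP[C CE] : (row_base (kermx (A *m surviving_mx K B) *m A)
    <= kermx (A *m surviving_mx K B) *m A)%MS by rewrite eq_row_base.
(* [row_base] has as many rows as the rank, so [r] has to become that rank. *)
case: _ / rB lower {rn nB} => lower.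
have [F F1 FE] := linear_forms_of_mx A (C *m kermx (A *m surviving_mx K B)).
have Ffree : row_free (eval_mx A F).
  by rewrite FE -mulmxA -CE row_base_free.
have supB : mx_support (eval_mx A F) \subset B.
  apply/subsetP=> j; apply: contraTT => jB; apply/mx_supportPn => i.
  have: eval_mx A F *m surviving_mx K B = 0.
    by rewrite FE -!mulmxA mulmx_ker mulmx0.
  by move/mulmx_surviving_eq0; apply.
exists F; split=> //; apply/eqP; rewrite eqn_leq -{1}cB subset_leq_card //=.
by apply: lower; exists F.
Qed.

End Incidence.

Theorem theorem2p12 (K : fieldType) (s m : nat) (G : sgraph s m)
    (Gconn : connected_graph G) (Gbip : bipartite_graph G) :
  let A := incidence_mx K G in
  let X := proj_points A in
  [/\ \dim (rm_code A 1) = (s - 1)%N,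
      forall d : nat, (2 <= d)%N -> \dim (rm_code A d) = m,
      forall r : nat, (1 <= r <= s - 1)%N ->
        exists2 n : nat, edge_connectivity G r n & gen_min_dist X 1 r n
    & forall d r : nat, (2 <= d)%N -> (1 <= r <= m)%N ->
        gen_min_dist X d r r].
Proof.
move=> A X; have [U Ubip] := Gbip; split.
- by rewrite dim_code1 (rank_incidence K Ubip Gconn).
- by move=> d d2; apply/dim_code_separating/incidence_separating.
- move=> r /andP[r0 rs]; have rs' : (r < s)%N by case: (s) rs => [|n]; rewrite ?subn1 //; case: (r) r0.
  have [n rn] := edge_connectivity_exists K Ubip Gconn rs'.
  by exists n => //; apply: gen_min_dist_edge_connectivity.
move=> d r d2 /andP[_ rm].
by apply: gen_min_dist_separating rm => [||];
  [apply: incidence_col_neq0 | apply: incidence_line_inj | apply: incidence_separating].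
Qed.
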